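(* Let $r$ be a non-negative integer. (1) Let $G$ be a digraph with $n$ vertices, let $P_{\tilde\pi}$ be the weighted poset induced by $G$, with $m$ elements, and let $\varphi_{\tilde\pi}:\mathbb{F}_2^n\to\mathbb{F}_2^m$ be the associated map. If $C\subseteq\mathbb{F}_2^n$ is an $r$-covering $G$-code, then $C^{\varphi_{\tilde\pi}}=\{x^{\varphi_{\tilde\pi}}: x\in C\}$ is an $r$-covering $P_{\tilde\pi}$-code. (2) Let $P_\pi$ be a weighted poset with $m$ elements and total weight $n$, let $G_\pi$ be the digraph induced by $P_\pi$, and let $\varphi_\pi:\mathbb{F}_2^m\to\mathbb{F}_2^n$ be the associated map. If $C\subseteq\mathbb{F}_2^m$ is an $r$-packing $P_\pi$-code, then $C^{\varphi_\pi}=\{u^{\varphi_\pi}:u\in C\}$ is an $r$-packing $G_\pi$-code.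
   Context: Binary vectors are identified with their supports. **Weighted posets.** A weighted poset $P_\pi$ is a finite poset $(P,\preceq)$ with a function $\pi:P\to\{1,2,3,\dots\}$. Coordinates of vectors in $\mathbb{F}_2^{m}$, $m=|P|$, are labelled by $P$. For $A\subseteq P$, $\langle A\rangle_P$ is the smallest order ideal (down-closed subset) containing $A$. Put $w_{P_\pi}(x)=\sum_{i\in\langle x\rangle_P}\pi(i)$ and $d_{P_\pi}(x,y)=w_{P_\pi}(x-y)$. The total weight of $P_\pi$ is $\sum_{i\in P}\pi(i)$. **Digraphs.** A digraph $G$ is a finite directed graph without loops or multiple edges. Coordinates of $\mathbb{F}_2^n$, $n=|V(G)|$, are labelled by $V(G)$. For $S\subseteq V(G)$, $\langle S\rangle_G$ is the set consisting of $S$ and all vertices reachable by a directed path from a vertex of $S$. Put $w_G(x)=|\langle x\rangle_G|$ and $d_G(x,y)=w_G(x-y)$. **Codes.** Let $*$ be a weighted poset or a digraph. A $*$-code is a subset $C$ of the corresponding space with metric $d_*$. Let $S_*(x;r)=\{y: d_*(x,y)\le r\}$. $C$ is $r$-covering if $\bigcup_{c\in C}S_*(c;r)$ is the whole space, and $r$-packing if the spheres $S_*(c;r)$, $c\in C$, are pairwise disjoint. **Weighted poset induced by a digraph.** Given $G$, write $u\sim v$ if $u=v$ or there are directed paths from $u$ to $v$ and from $v$ to $u$; $\bar v$ is the class of $v$. Set $\bar u\preceq\bar v$ if $\bar u=\bar v$ or there is a path from some $a\in\bar v$ to some $b\in\bar u$. Then $P_{\tilde\pi}$ is the poset $(V(G)/{\sim},\preceq)$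 with weights $\tilde\pi(\bar v)=|\bar v|$. Let its elements be $\bar1,\dots,\bar m$ and write $x\in\mathbb{F}_2^n$ as $(X_{\bar1},\dots,X_{\bar m})$, where $X_{\bar i}\in\mathbb{F}_2^{|\bar i|}$ is the restriction of $x$ to $\bar i$. Then $x^{\varphi_{\tilde\pi}}=(x_{\bar1},\dots,x_{\bar m})$ with $x_{\bar i}=0$ if $X_{\bar i}=0$ and $x_{\bar i}=1$ otherwise. **Digraph induced by a weighted poset.** Given $P_\pi$, for $a\in P$ let $\hat a=\{a_0,a_1,\dots,a_{\pi(a)-1}\}$ with $a_0=a$ (these sets are disjoint for different $a$). $G_\pi$ has vertex set $\bigcup_{a}\hat a$, and edges $(a,b)$ for $b\preceq a$, $b\neq a$ in $P$, together with the edges $(a_i,a_{i+1})$, subscripts modulo $\pi(a)$, for every $a$ with $\pi(a)\ge2$. For $u\in\mathbb{F}_2^m$, $u^{\varphi_\pi}\in\mathbb{F}_2^n$ is the vector whose restriction to $\hat a$ is $(u_a,0,\dots,0)$ (value $u_a$ at $a_0$, and $0$ at the other vertices of $\hat a$), for every $a\in P$. *)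

(* Defs.v *)
From HB Require Import structures.
From mathcomp Require Import all_boot all_order all_algebra.

Set Implicit Arguments.
Unset Strict Implicit.
Unset Printing Implicit Defensive.

Import Order.TTheory GRing.Theory.

Notation binvec T := {ffun T -> 'F_2}.

Definition supp (T : finType) (x : binvec T) : {set T} :=
  [set i | x i != 0%R].

Definition sphere (X : finType) (d : X -> X -> nat) (x : X) (r : nat) :
  {set X} := [set y | d x y <= r].

Definition covering (X : finType) (d : X -> X -> nat) (r : nat) (C : {set X}) :
  Prop := \bigcup_(c in C) sphere d c r = [set: X].

Definition packing (X : finType) (d : X -> X -> nat) (r : nat) (C : {set X}) :
  Prop :=
  {in C &, forall c c', c != c' -> [disjoint sphere d c r & sphere d c' r]}.

Record wposet (disp : Order.disp_t) := WPoset {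
  wposet_sort :> finPOrderType disp;
  weight : wposet_sort -> nat;
  weight_gt0 : forall a, 0 < weight a }.

Definition order_ideal (disp : Order.disp_t) (P : finPOrderType disp)
  (I : {set P}) : bool :=
  [forall i in I, forall j, (j <= i)%O ==> (j \in I)].

Definition ideal (disp : Order.disp_t) (P : finPOrderType disp) (A : {set P}) :
  {set P} := \bigcap_(I : {set P} | order_ideal I && (A \subset I)) I.

Definition wP (disp : Order.disp_t) (P : wposet disp) (x : binvec P) : nat :=
  \sum_(i in ideal (supp x)) weight i.

Definition dP (disp : Order.disp_t) (P : wposet disp) (x y : binvec P) : nat :=
  wP (x - y)%R.

Record digraph := Digraph {
  vertex :> finType;
  edge : rel vertex;
  edge_irr : irreflexive edge }.

Definition reach (G : digraph) (S : {set G}) : {set G} :=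
  [set v | [exists u in S, connect (@edge G) u v]].

Definition wG (G : digraph) (x : binvec G) : nat := #|reach (supp x)|.

Definition dG (G : digraph) (x y : binvec G) : nat := wG (x - y)%R.

(* [connect] is reflexive, so this includes [u = v]. *)
Definition mutual (G : digraph) : rel G :=
  [rel u v | connect (@edge G) u v && connect (@edge G) v u].

Definition scc (G : digraph) :=
  {A : {set G} | A \in equivalence_partition (@mutual G) [set: G]}.

HB.instance Definition _ (G : digraph) := Finite.on (scc G).

Definition scc_le (G : digraph) : rel (scc G) := fun A B =>
  (A == B) || [exists a in val B, exists b in val A, connect (@edge G) a b].

Lemma scc_mutual (G : digraph) (A : scc G) (u v : G) :
  u \in val A -> v \in val A -> mutual u v.
Proof.
move: (valP A) => /= /imsetP[x _ ->]; rewrite !inE /=.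
move=> /andP[xu ux] /andP[xv vx].
by rewrite /mutual /= (connect_trans ux xv) (connect_trans vx xu).
Qed.

Lemma scc_eq (G : digraph) (A B : scc G) (u v : G) :
  u \in val A -> v \in val B -> mutual u v -> A = B.
Proof.
move=> uA vB /andP[uv vu]; apply: val_inj; move: uA vB.
case/imsetP: (valP A) (valP B) => x _ -> /imsetP[y _ ->].
rewrite !inE /= => /andP[xu ux] /andP[yv vy].
have xy : connect (@edge G) x y := connect_trans xu (connect_trans uv vy).
have yx : connect (@edge G) y x := connect_trans yv (connect_trans vu ux).
apply/setP=> w; rewrite !inE /=; apply/andP/andP=> -[h1 h2]; split.
- exact: connect_trans yx h1.
- exact: connect_trans h2 xy.
- exact: connect_trans xy h1.
- exact: connect_trans h2 yx.
Qed.

Lemma scc_leP (G : digraph) (A B : scc G) (u v : G) :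
  u \in val A -> v \in val B -> scc_le A B = connect (@edge G) v u.
Proof.
move=> uA vB; apply/orP/idP=> [[/eqP AB|/exists_inP[a aB /exists_inP[b bA ab]]]|vu].
- by rewrite AB in uA; case/andP: (scc_mutual uA vB).
- have /andP[va _] := scc_mutual vB aB; have /andP[bu _] := scc_mutual bA uA.
  exact: connect_trans (connect_trans va ab) bu.
by right; apply/exists_inP; exists v => //; apply/exists_inP; exists u.
Qed.

Lemma scc_inh (G : digraph) (A : scc G) : exists u, u \in val A.
Proof.
move: (valP A) => /= /imsetP[x _ ->]; exists x.
by rewrite !inE /mutual /= connect0.
Qed.

Lemma scc_le_refl (G : digraph) : reflexive (@scc_le G).
Proof. by move=> A; rewrite /scc_le eqxx. Qed.

Lemma scc_le_anti (G : digraph) : antisymmetric (@scc_le G).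
Proof.
move=> A B; have [u uA] := scc_inh A; have [v vB] := scc_inh B.
rewrite (scc_leP uA vB) (scc_leP vB uA) andbC; exact: scc_eq.
Qed.

Lemma scc_le_trans (G : digraph) : transitive (@scc_le G).
Proof.
move=> B A D; have [u uA] := scc_inh A; have [v vB] := scc_inh B.
have [w wD] := scc_inh D.
rewrite (scc_leP uA vB) (scc_leP vB wD) (scc_leP uA wD) => vu wv.
exact: connect_trans wv vu.
Qed.

Fact scc_display : Order.disp_t. Proof. exact: Order.Disp tt tt. Qed.

HB.instance Definition _ (G : digraph) :=
  Order.Le_isPOrder.Build scc_display (scc G)
    (@scc_le_refl G) (@scc_le_anti G) (@scc_le_trans G).

Definition scc_weight (G : digraph) (A : scc G) : nat := #|val A|.

Lemma scc_weight_gt0 (G : digraph) (A : scc G) : 0 < scc_weight A.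
Proof. by apply/card_gt0P; exact: scc_inh. Qed.

Definition wposet_of_digraph (G : digraph) : wposet scc_display :=
  @WPoset scc_display (scc G) (@scc_weight G) (@scc_weight_gt0 G).

Definition phi_digraph (G : digraph) (x : binvec G) :
  binvec (wposet_of_digraph G) :=
  [ffun A : scc G => if [forall v in val A, x v == 0%R] then 0%R else 1%R].

(* The vertex [Tagged _ i] with tag [a] stands for a_i; in particular a itself
   is identified with a_0. *)
Definition gvertex (disp : Order.disp_t) (P : wposet disp) : finType :=
  {a : P & 'I_(weight a)}.

Definition gedge (disp : Order.disp_t) (P : wposet disp) : rel (gvertex P) :=
  fun u v =>
    [&& val (tagged u) == 0, val (tagged v) == 0,
        (tag v <= tag u)%O & tag v != tag u]
    || [&& tag u == tag v, 1 < weight (tag u)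
         & val (tagged v) == (val (tagged u)).+1 %% weight (tag u)].

Lemma gedge_irr (disp : Order.disp_t) (P : wposet disp) :
  irreflexive (@gedge _ P).
Proof.
case=> a i; rewrite /gedge /= eqxx !andbF /=; apply/negP=> /andP[w1 /eqP].
have := ltn_ord i; rewrite leq_eqVlt => /orP[/eqP e|lt].
  by rewrite e modnn => i0; rewrite i0 in e; rewrite -e in w1.
by rewrite modn_small // => /n_Sn.
Qed.

Definition digraph_of_wposet (disp : Order.disp_t) (P : wposet disp) : digraph :=
  Digraph (@gedge_irr _ P).

Definition phi_wposet (disp : Order.disp_t) (P : wposet disp) (u : binvec P) :
  binvec (digraph_of_wposet P) :=
  [ffun v : gvertex P => if val (tagged v) == 0 then u (tag v) else 0%R].

(* Main.v *)
Require Import Defs.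
From mathcomp Require Import all_boot all_order all_algebra.

(** Both halves rest on a non-expansive map from the digraph space to the
    poset space.

    For (1) this is [phi_digraph] itself.  It is onto, because a binary vector
    on the components lifts to the vector constant on each component, and a
    non-expansive surjection carries coverings to coverings.

    For (2) it is the map [restrict0] reading off the coordinates a_0.  It is a
    left inverse of [phi_wposet], so a point common to two spheres around
    codewords [phi_wposet u] and [phi_wposet u'] is sent to a point common to
    the spheres around u and u'.

    Each of the two maps is local: its value at a poset element a depends only
    on the coordinates in a fibre of [weight a] vertices, a strongly connected
    component in (1) and the cycle on a_0, a_1, ... in (2).  So where the images
    of x and y differ at a, the support of x - y meets the fibre of a, and every
    vertex in the fibres of the elements below a is reachable from it.  Distinct
    fibres are disjoint, hence the total weight of the ideal counts distinct
    reachable vertices ([wP_le_wG]), which is non-expansiveness. *)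

Set Implicit Arguments.
Unset Strict Implicit.
Unset Printing Implicit Defensive.

Import Order.TTheory GRing.Theory.

Lemma covering_image (X Y : finType) (dX : X -> X -> nat) (dY : Y -> Y -> nat)
    (f : X -> Y) (g : Y -> X) (r : nat) (C : {set X}) :
  cancel g f -> (forall x x', dY (f x) (f x') <= dX x x') ->
  covering dX r C -> covering dY r [set f x | x in C].
Proof.
move=> gK f_le covC; apply/setP=> y; rewrite inE.
have : g y \in [set: X] by [].
rewrite -covC => /bigcupP[c cC]; rewrite inE => cgy.
apply/bigcupP; exists (f c); first exact: imset_f.
by rewrite inE -[y]gK; apply: leq_trans (f_le _ _) cgy.
Qed.

Lemma packing_image (X Y : finType) (dX : X -> X -> nat) (dY : Y -> Y -> nat)
    (f : X -> Y) (g : Y -> X) (r : nat) (C : {set X}) :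
  cancel f g -> (forall y y', dX (g y) (g y') <= dY y y') ->
  packing dX r C -> packing dY r [set f x | x in C].
Proof.
move=> fK g_le packC _ _ /imsetP[c cC ->] /imsetP[c' c'C ->] fcc'.
have cc' : c != c' by apply: contraNneq fcc' => ->.
have /pred0P dis := packC c c' cC c'C cc'.
apply/pred0P=> y /=; apply/negP=> /andP[]; rewrite !inE => cy c'y.
move: (dis (g y)); rewrite /= !inE -{1}[c]fK -{1}[c']fK.
by rewrite (leq_trans (g_le _ _) cy) (leq_trans (g_le _ _) c'y).
Qed.

Lemma mem_supp_sub (T : finType) (x y : binvec T) (i : T) :
  (i \in supp (x - y)%R) = (x i != y i).
Proof. by rewrite inE !ffunE subr_eq0. Qed.

Lemma in_ideal (disp : Order.disp_t) (P : finPOrderType disp) (A : {set P})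
    (j : P) :
  j \in ideal A -> exists2 i, i \in A & (j <= i)%O.
Proof.
(* The down-closure of A is one of the ideals being intersected. *)
pose D := [set k | [exists i in A, (k <= i)%O]].
move/bigcapP/(_ D)=> jD; suff: j \in D by rewrite inE => /exists_inP.
apply: jD; apply/andP; split.
  apply/forall_inP=> k; rewrite inE => /exists_inP[i iA ki].
  apply/forallP=> l; apply/implyP=> lk; rewrite inE.
  by apply/exists_inP; exists i; rewrite // (le_trans lk ki).
by apply/subsetP=> i iA; rewrite inE; apply/exists_inP; exists i.
Qed.

(** Since the fibres [F b] are disjoint and have size [weight b], the weight of
    the ideal is the size of the union of the fibres over it.  The hypotheses
    are phrased so as to cover both the components of a digraph and the cycles
    built from a weighted poset. *)
Lemma wP_le_wG (disp : Order.disp_t) (P : wposet disp) (G : digraph)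
    (F : P -> {set G}) (x : binvec P) (y : binvec G) :
  (forall a b, a != b -> [disjoint F a & F b]) ->
  (forall a, #|F a| = weight a) ->
  (forall a b, a \in supp x -> (b <= a)%O -> F b \subset reach (supp y)) ->
  wP x <= wG y.
Proof.
move=> disF cardF subF; rewrite /wP /wG.
(* Emptying the fibres outside the ideal makes the union run over all of P. *)
pose F' b := if b \in ideal (supp x) then F b else set0.
have disF' a b : a != b -> [disjoint F' a & F' b].
  rewrite /F' -setI_eq0 => /disF; rewrite -setI_eq0.
  by do 2!case: ifP => _ //; rewrite ?setI0 ?set0I ?eqxx.
have -> : \sum_(b in ideal (supp x)) weight b = #|\bigcup_b F' b|.
  rewrite -sum1_card partition_disjoint_bigcup // big_mkcond.
  apply: eq_bigr => b _; rewrite sum1_card -cardF /F'.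
  by case: ifP => // _; rewrite cards0.
apply/subset_leq_card/bigcupsP=> b _; rewrite /F'.
case: ifP; last by rewrite sub0set.
by move=> /in_ideal[a ax ba]; apply: subF ba.
Qed.

Lemma scc_cover (G : digraph) (v : G) : exists A : scc G, v \in val A.
Proof.
have vP : [set w in [set: G] | mutual v w]
            \in equivalence_partition (@mutual G) [set: G] by exact: imset_f.
by exists (exist _ [set w in [set: G] | mutual v w] vP);
  rewrite !inE /mutual /= connect0.
Qed.

Lemma scc_disjoint (G : digraph) (A B : scc G) :
  A != B -> [disjoint val A & val B].
Proof.
move=> neqAB; apply/pred0P=> v /=; apply: contraNF neqAB => /andP[vA vB].
by apply/eqP/(scc_eq vA vB); rewrite /mutual /= connect0.
Qed.

Lemma phi_digraph_le (G : digraph) (x y : binvec G) :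
  dP (phi_digraph x) (phi_digraph y) <= dG x y.
Proof.
apply: (@wP_le_wG _ (wposet_of_digraph G) G (fun A : scc G => val A)) => //.
  exact: scc_disjoint.
move=> A B; rewrite mem_supp_sub => xyA BA.
(* Were x and y equal on the component A, their images would agree at A. *)
have [u uA xyu] : exists2 u, u \in val A & x u != y u.
  apply/exists_inP; apply: contraNT xyA; rewrite negb_exists_in.
  move=> /forall_inP xy; rewrite !ffunE; apply/eqP; congr (if _ then _ else _).
  by apply: eq_forallb_in => v vA; have /negPn/eqP-> := xy v vA.
apply/subsetP=> v vB; rewrite inE; apply/exists_inP; exists u.
  by rewrite mem_supp_sub.
by rewrite -(scc_leP vB uA).
Qed.

(** Components are disjoint, so the chosen one is the component of v and the
    vector is constant on each component. *)
Definition lift_digraph (G : digraph) (y : binvec (wposet_of_digraph G)) :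
    binvec G :=
  [ffun v => y (xchoose (scc_cover v))].

Lemma lift_digraphK (G : digraph) :
  cancel (@lift_digraph G) (@phi_digraph G).
Proof.
move=> y; apply/ffunP=> A; rewrite ffunE.
have liftE v : v \in val A -> lift_digraph y v = y A.
  move=> vA; rewrite ffunE; congr (y _).
  apply: (scc_eq (xchooseP (scc_cover v)) vA).
  by rewrite /mutual /= connect0.
have [u uA] := scc_inh A.
case: forall_inP => [/(_ u uA)|nz]; first by rewrite liftE // => /eqP.
have: y A != 0%R.
  by apply/negP=> yA; apply: nz => v vA; rewrite liftE.
(* 1 is the only non-zero element of F_2. *)
by case: (y A) => [[|[|]]] // ? _; apply: val_inj.
Qed.

Section Cycles.
Variables (disp : Order.disp_t) (P : wposet disp).
Implicit Types (a b : P).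

Definition vertex0 a : digraph_of_wposet P :=
  Tagged (fun a => 'I_(weight a)) (Ordinal (weight_gt0 a)).

Definition cycle_of a : {set digraph_of_wposet P} :=
  [set v : gvertex P | tag v == a].

Lemma card_cycle_of a : #|cycle_of a| = weight a.
Proof.
pose t (i : 'I_(weight a)) : gvertex P := Tagged (fun a => 'I_(weight a)) i.
have t_inj : injective t by move=> i j /eqP; rewrite eq_Tagged => /eqP.
rewrite -[RHS]card_ord -(card_imset predT t_inj); apply: eq_card => v.
rewrite inE; apply/eqP/imsetP=> [|[i _ ->] //].
by case: v => b i /= ab; case: _ / ab in t t_inj *; exists i.
Qed.

Lemma connect_cycle_of a (v : digraph_of_wposet P) :
  v \in cycle_of a -> connect (@edge (digraph_of_wposet P)) (vertex0 a) v.
Proof.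
rewrite inE; case: v => b [k lt_k] /= /eqP ab; subst b.
elim: k lt_k => [|k IHk] lt_k.
  by apply: eq_connect0; congr existT; apply: val_inj.
apply: connect_trans (IHk (ltnW lt_k)) (connect1 _).
by rewrite /= /gedge /= eqxx modn_small // (leq_trans _ lt_k) ?eqxx ?orbT.
Qed.

Lemma connect_vertex0 a b :
  (b <= a)%O ->
  connect (@edge (digraph_of_wposet P)) (vertex0 a) (vertex0 b).
Proof.
move=> ba; have [->|neqba] := eqVneq b a; first exact: connect0.
by apply: connect1; rewrite /= /gedge /= ba neqba.
Qed.

Definition restrict0 (y : binvec (digraph_of_wposet P)) : binvec P :=
  [ffun a => y (vertex0 a)].

Lemma phi_wposetK : cancel (@phi_wposet _ P) restrict0.
Proof. by move=> u; apply/ffunP=> a; rewrite !ffunE. Qed.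

Lemma restrict0_le (x y : binvec (digraph_of_wposet P)) :
  dP (restrict0 x) (restrict0 y) <= dG x y.
Proof.
apply: (@wP_le_wG _ P (digraph_of_wposet P) cycle_of) card_cycle_of _
  => [a b neqab|a b].
  apply/pred0P=> v /=; apply: contraNF neqab; rewrite !inE.
  by move=> /andP[/eqP-> /eqP->].
rewrite mem_supp_sub !ffunE => xya ba; apply/subsetP=> v vb.
rewrite inE; apply/exists_inP; exists (vertex0 a); first by rewrite mem_supp_sub.
exact: connect_trans (connect_vertex0 ba) (connect_cycle_of vb).
Qed.

End Cycles.

Theorem theorem2p5 (r : nat) :
  (forall (G : digraph) (C : {set binvec G}),
      covering (@dG G) r C ->
      covering (@dP _ (wposet_of_digraph G)) r [set phi_digraph x | x in C])
  /\
  (forall (disp : Order.disp_t) (P : wposet disp) (C : {set binvec P}),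
      packing (@dP _ P) r C ->
      packing (@dG (digraph_of_wposet P)) r [set phi_wposet u | u in C]).
Proof.
split=> [G C|disp P C].
  exact: covering_image (@lift_digraphK G) (@phi_digraph_le G).
exact: packing_image (@phi_wposetK _ P) (@restrict0_le _ P).
Qed.
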